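(* Let $n \ge 1$ and $r \ge 1$ be integers. (a) The Hadamard product of two $n \times n$ real TN$_r$ Hankel matrices is TN$_r$. (b) The Hadamard product of two $n \times n$ real TP$_r$ Hankel matrices is TP$_r$.
   Context: A square matrix $A=(a_{ij})_{1\le i,j\le n}$ is Hankel if $a_{ij}$ depends only on $i+j$. A real matrix is TN$_r$ (totally nonnegative of order $r$) if every minor (determinant of a square submatrix) of size $\le r$ is nonnegative, and TP$_r$ (totally positive of order $r$) if every minor of size $\le r$ is positive. The Hadamard (entrywise) product of two matrices $A=(a_{ij})$ and $B=(b_{ij})$ of the same size is $A\circ B = (a_{ij}b_{ij})$. *)

(* Defs.v *)
From mathcomp Require Import all_boot all_order all_algebra.
From mathcomp Require Import reals.

Set Implicit Arguments.
Unset Strict Implicit.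
Unset Printing Implicit Defensive.

Import Order.TTheory GRing.Theory Num.Theory.
Local Open Scope ring_scope.

Definition hankel (T : Type) (n : nat) (A : 'M[T]_n) : Prop :=
  forall i j k l : 'I_n, (i + j = k + l)%N -> A i j = A k l.

Definition increasing (k n : nat) (f : 'I_k -> 'I_n) : Prop :=
  forall i j : 'I_k, (i < j)%N -> (f i < f j)%N.

(* A k x k submatrix is selected by an increasing enumeration f of its rows
   and g of its columns. The case k = 0 is harmless, as \det of a 0 x 0 matrix
   is 1; sizes k > n are vacuous, as there is no increasing 'I_k -> 'I_n. *)
Definition TN (R : realType) (r n : nat) (A : 'M[R]_n) : Prop :=
  forall (k : nat) (f g : 'I_k -> 'I_n),
    (k <= r)%N -> increasing f -> increasing g -> 0 <= \det (mxsub f g A).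

Definition TP (R : realType) (r n : nat) (A : 'M[R]_n) : Prop :=
  forall (k : nat) (f g : 'I_k -> 'I_n),
    (k <= r)%N -> increasing f -> increasing g -> 0 < \det (mxsub f g A).

Definition hadamard (R : realType) (n : nat) (A B : 'M[R]_n) : 'M[R]_n :=
  map2_mx *%R A B.

(* Main.v *)
(* Every contiguous submatrix of a Hankel matrix is itself Hankel, hence symmetric. So for a TN_r (TP_r) Hankel matrix the contiguous blocks of size at most r are positive semidefinite (definite), and by the Schur product theorem so are those of the Hadamard product. If they are definite, all contiguous minors of size at most r are positive, and Fekete's criterion makes all minors of size at most r positive. In the TN_r case, add e * M to the product, where M is a Hankel moment matrix whose contiguous blocks are positive definite, and let e tend to 0. *)
Require Import Defs.
From mathcomp Require Import all_boot all_order all_algebra.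
From mathcomp Require Import reals.
From mathcomp Require polyrcf.
From mathcomp Require Import zify ring.

Set Implicit Arguments.
Unset Strict Implicit.
Unset Printing Implicit Defensive.

Import Order.TTheory GRing.Theory Num.Theory.
Local Open Scope ring_scope.

(** * Minors and Fekete's criterion *)

Definition minor (R : comPzRingType) (F : nat -> nat -> R) (k : nat)
    (f g : nat -> nat) : R :=
  \det (\matrix_(i < k, j < k) F (f i) (g j)).

(* [f] enumerates k increasing indices below N; its values at arguments >= k are irrelevant. *)
Definition incr_on (k N : nat) (f : nat -> nat) : Prop :=
  (forall i, (i.+1 < k)%N -> (f i < f i.+1)%N) /\
  (forall i, (i < k)%N -> (f i < N)%N).

Section Minors.
Variable R : comNzRingType.
Implicit Types F : nat -> nat -> R.

Lemma eq_minor F G k f f' g g' :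
  (forall i j, (i < k)%N -> (j < k)%N -> F (f i) (g j) = G (f' i) (g' j)) ->
  minor F k f g = minor G k f' g'.
Proof. by move=> e; congr (\det _); apply/matrixP=> i j; rewrite !mxE e. Qed.

Lemma minor_tr F k f g : minor F k f g = minor (fun j i => F i j) k g f.
Proof. by rewrite /minor -det_tr; congr (\det _); apply/matrixP=> i j; rewrite !mxE. Qed.

(* Determinant with first row [s] and further rows [o 0], ..., [o m.-1], in columns 1, ..., m.+1, expanded along the row [s]. *)
Definition sdet F m (o : nat -> nat) (s : nat) : R :=
  \sum_(j < m.+1) F s j.+1 *
    ((-1) ^+ j * \det (\matrix_(i < m, l < m) F (o i) (bump j l).+1)).

(** Laplace expansion along row [q]: its cofactor signs differ from those of a first row by the
    factor [(-1) ^+ q]. *)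
Lemma minor_sdet F m (o f : nat -> nat) q : (q <= m)%N ->
  (forall i, (i < m)%N -> f (bump q i) = o i) ->
  minor F m.+1 f succn = (-1) ^+ q * sdet F m o (f q).
Proof.
move=> qm fo; have qm' : (q < m.+1)%N by [].
rewrite /minor (expand_det_row _ (Ordinal qm')) /sdet mulr_sumr.
apply: eq_bigr => j _; rewrite !mxE /cofactor /= exprD.
set d1 := \det _; set d2 := \det _; have -> : d1 = d2.
  by congr (\det _); apply/matrixP=> i l; rewrite !mxE /= fo.
by ring.
Qed.

Lemma sdet_dup F m o i : (i < m)%N -> sdet F m o (o i) = 0.
Proof.
move=> im.
pose f t := if t is t'.+1 then o t' else o i.
have /esym := @minor_sdet F m o f 0%N (leq0n _) (fun t _ => erefl).
rewrite expr0 mul1r => ->.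
have im' : (i.+1 < m.+1)%N by [].
by apply: (@determinant_alternate _ _ _ ord0 (Ordinal im')) => // j; rewrite !mxE.
Qed.

(** Put a copy of column [j] before the first [k] columns: the resulting square matrix has two equal
    columns, and the sum is the expansion of its determinant along the copy. *)
Lemma alternating_minors F k j : (j < k)%N ->
  \sum_(s < k.+1) (-1) ^+ s * minor F k (bump s) id * F s j = 0.
Proof.
move=> jk; pose c t := if t is t'.+1 then t' else j.
have c0 : minor F k.+1 id c = 0.
  have jk' : (j.+1 < k.+1)%N by [].
  rewrite minor_tr /minor.
  by apply: (@determinant_alternate _ _ _ ord0 (Ordinal jk')) => // l; rewrite !mxE.
rewrite -[RHS]c0 /minor (expand_det_col _ ord0); apply: eq_bigr => s _.
rewrite !mxE /cofactor addn0 mulrC; congr (_ * (_ * \det _)).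
by apply/matrixP=> a b; rewrite !mxE.
Qed.

(* Pluecker relation: with S = {0, ..., m+2}, p = q + 1, D_s the maximal minor on S \ s and E_st the minor on S \ {s,t} without the first column, it reads D_p E_0k = D_0 E_pk + D_k E_0p for k = m + 2. *)
Lemma three_term F m q : (q <= m)%N ->
  minor F m.+2 (bump q.+1) id * minor F m.+1 succn succn =
  minor F m.+2 succn id * minor F m.+1 (bump q.+1) succn +
  minor F m.+2 id id * minor F m.+1 (succn \o bump q) succn.
Proof.
move=> qm; pose o := succn \o bump q.
(* [sdet F m o s] is a combination of the entries [F s j.+1] with coefficients free of [s], so the
   sum over [s] vanishes column by column. *)
have sum0 : \sum_(s < m.+3) (-1) ^+ s * minor F m.+2 (bump s) id * sdet F m o s = 0.
  under eq_bigr do rewrite mulr_sumr; rewrite exchange_big /=.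
  apply: big1 => j _; under eq_bigr do rewrite mulrA.
  by rewrite -mulr_suml alternating_minors ?mul0r // ltnS.
have := sum0; rewrite big_ord_recl big_ord_recr /=.
have qm' : (q < m.+1)%N by [].
(* Any [s] other than [0], [q.+1] and [m.+2] is a value of [o], which gives [sdet] a repeated
   row. *)
rewrite (bigD1 (Ordinal qm')) //= big1 => [|t tq]; last first.
  case: (unliftP (Ordinal qm') t) tq => [u ->|->]; last by rewrite eqxx.
  have -> : bump 0%N (lift (Ordinal qm') u) = o u by [].
  by rewrite sdet_dup ?mulr0.
have e0 : minor F m.+2 (bump 0%N) id = minor F m.+2 succn id by [].
have eq1 : bump 0%N q = q.+1 by [].
have em1 : bump 0%N m.+1 = m.+2 by [].
have ek : minor F m.+2 (bump m.+2) id = minor F m.+2 id id.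
  by apply: eq_minor => i j im _; rewrite /bump leqNgt im.
rewrite e0 !eq1 !em1 ek !addr0.
(* Inserted in increasing order into [o], the rows [q.+1], [0] and [m.+2] take positions [q], [0]
   and [m]. *)
rewrite (@minor_sdet F m o succn q) //.
rewrite (@minor_sdet F m o (bump q.+1) 0%N) //; last first.
  by move=> i _; rewrite /o /= /bump /=; lia.
rewrite (@minor_sdet F m o (succn \o bump q) m) //; last first.
  by move=> i im; rewrite /o /= /bump; lia.
have -> : bump q.+1 0%N = 0%N by [].
have -> : (succn \o bump q) m = m.+2 by rewrite /= /bump qm.
rewrite !exprS expr0; set x := (-1) ^+ q; set y := (-1) ^+ m => e.
by apply/eqP; rewrite -subr_eq0 -oppr_eq0 -[X in _ == X]e; apply/eqP; ring.
Qed.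

End Minors.

Lemma incr_on_add k N i : (i + k <= N)%N -> incr_on k N (addn i).
Proof. by move=> ikN; split=> j jk; lia. Qed.

Lemma incr_onP k N f i d : incr_on k N f -> (i + d < k)%N -> (f i + d <= f (i + d))%N.
Proof.
move=> [inc _]; elim: d => [|d IH] idk; first by rewrite !addn0.
rewrite !addnS; have := IH ltac:(lia); have := inc (i + d)%N ltac:(lia); lia.
Qed.

Section Fekete.
Variable R : realDomainType.
Implicit Types F : nat -> nat -> R.

Lemma incr_on_gap k N f : incr_on k.+1 N f -> (f 0 + k < f k)%N ->
  exists2 q, (q < k)%N & ((f q).+1 < f q.+1)%N.
Proof.
move=> [inc _]; elim: k inc => [|k IH] inc fk; first by lia.
have [lt|le] := ltnP (f k).+1 (f k.+1); first by exists k.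
have [||q qk h] := IH; first by move=> i ik; apply: inc; lia.
  by lia.
by exists q => //; lia.
Qed.

(* Induction on the spread [f m.+1 - f 0]: the rows f together with an index h in a gap of f satisfy the three-term relation, whose right-hand side only involves row sets with an extreme index replaced by h. *)
Lemma fekete_rows F N m :
  (forall f, incr_on m.+1 N f -> 0 < minor F m.+1 f succn) ->
  (forall i, (i + m.+2 <= N)%N -> 0 < minor F m.+2 (addn i) id) ->
  forall f, incr_on m.+2 N f -> 0 < minor F m.+2 f id.
Proof.
move=> small contig f; have [d] := ubnP (f m.+1 - f 0)%N.
elim: d f => // d IH f fd fi; have [inc bnd] := fi.
have [gap|nogap] := ltnP (f 0 + m.+1)%N (f m.+1); last first.
  rewrite (@eq_minor _ _ F _ _ (addn (f 0%N)) _ id).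
    by apply: contig; have := bnd m.+1 (leqnn _); have := incr_onP (i := 0%N) (d := m.+1) fi (leqnn _); rewrite add0n; lia.
  move=> i j im _; congr F; have := incr_onP (i := 0%N) (d := i) fi im.
  have := incr_onP (i := i) (d := m.+1 - i) fi ltac:(lia).
  by rewrite add0n subnKC; lia.
have [q qm hq] := incr_on_gap fi gap.
(* [s] inserts the skipped row [(f q).+1] at position [q.+1]. Deleting that position gives back [f];
   deleting either end narrows the spread. *)
pose s i := if (i <= q)%N then f i else if i == q.+1 then (f q).+1 else f i.-1.
have s_lo i : (i <= q)%N -> s i = f i by rewrite /s => ->.
have s_mid : s q.+1 = (f q).+1 by rewrite /s ltnn eqxx.
have s_hi i : (q < i)%N -> s i.+1 = f i.
  by move=> qi; rewrite /s eqSS ltnNge (ltnW qi) /= gtn_eqF.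
have sinc : incr_on m.+3 N s.
  split=> i ik.
    have [iq|qi|->] := ltngtP i q.
    - by rewrite !s_lo //; [apply: inc; lia|lia].
    - case: i ik qi => // i ik; rewrite ltnS leq_eqVlt => /predU1P[<-|qi].
        by rewrite s_mid s_hi.
      by rewrite !s_hi; [apply: inc| |]; lia.
    - by rewrite s_mid s_lo.
  have := bnd q.+1 ltac:(lia) => b1.
  have [iq|qi] := leqP i q; first by rewrite s_lo //; apply: bnd; lia.
  case: i ik qi => // i ik; rewrite ltnS leq_eqVlt => /predU1P[<-|qi].
    by rewrite s_mid; lia.
  by rewrite s_hi //; apply: bnd; lia.
have [sI sB] := sinc.
have s0 : s 0%N = f 0%N by rewrite s_lo.
have sk : s m.+2 = f m.+1 by rewrite s_hi.
have s_mono i j : (i < j)%N -> (j < m.+3)%N -> (s i < s j)%N.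
  move=> ij jm; have := incr_onP (i := i) (d := j - i) sinc ltac:(lia).
  by rewrite subnKC; lia.
have inc_s k g : (forall i, (i.+1 < k)%N -> (g i < g i.+1)%N) ->
  (forall i, (i < k)%N -> (g i < m.+3)%N) -> incr_on k N (s \o g).
  move=> gi gb; split=> i ik /=; last exact: sB (gb _ ik).
  by apply: s_mono (gi _ ik) (gb _ ik).
have D0 : 0 < minor F m.+2 (s \o succn) id.
  apply: IH; last by apply: inc_s.
  by rewrite /= sk; have := s_mono 0%N 1%N isT isT; rewrite s0; lia.
have Dk : 0 < minor F m.+2 s id.
  apply: (IH s); last by apply: (inc_s _ id) => // i; lia.
  by rewrite s0; have := s_mono m.+1 m.+2 (leqnn _) (leqnn _); rewrite sk; lia.
have E0 : 0 < minor F m.+1 (s \o bump q.+1) succn.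
  by apply/small/inc_s => i im; rewrite /bump; lia.
have Ek : 0 < minor F m.+1 (s \o (succn \o bump q)) succn.
  by apply/small/inc_s => i im; rewrite /= /bump; lia.
have Ep : 0 < minor F m.+1 (s \o succn) succn.
  by apply/small/inc_s => i im; lia.
have := @three_term R (fun i j => F (s i) j) m q qm.
have ->: minor (fun i j => F (s i) j) m.+2 (bump q.+1) id = minor F m.+2 f id.
  apply: eq_minor => i j im _; congr F; rewrite /bump.
  by have [qi|iq] := ltnP q i; [exact: s_hi|exact: s_lo].
move=> e.
have : 0 < minor F m.+2 f id * minor F m.+1 (s \o succn) succn.
  by rewrite [X in _ < X]e; apply: addr_gt0; apply: mulr_gt0.
by rewrite pmulr_lgt0.
Qed.

(** Induction on the size with two uses of [fekete_rows]: the first frees the rows while the columns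
    stay contiguous, the second, after transposition, frees the columns for fixed rows [f]. *)
Lemma fekete F n r :
  (forall k i j, (k <= r)%N -> (i + k <= n)%N -> (j + k <= n)%N ->
     0 < minor F k (addn i) (addn j)) ->
  forall k f g, (k <= r)%N -> incr_on k n f -> incr_on k n g -> 0 < minor F k f g.
Proof.
move=> contig; elim=> [|[|m] IH] f g kr fi gi.
- by rewrite /minor det_mx00.
- have [_ /(_ 0%N isT) bf] := fi; have [_ /(_ 0%N isT) bg] := gi.
  rewrite (@eq_minor _ _ F _ _ (addn (f 0%N)) _ (addn (g 0%N))).
    by apply: contig; lia.
  by case=> // [[]] // _ _; rewrite !addn0.
have col j h : (j + m.+2 <= n)%N -> incr_on m.+2 n h -> 0 < minor F m.+2 h (addn j).
  move=> jn; apply: (@fekete_rows (fun a b => F a (j + b)%N)) => [e ei|i im].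
    by apply: (IH e (fun b => j + b.+1)%N) => //; [lia|split=> i im; lia].
  exact: contig.
rewrite minor_tr; apply: (@fekete_rows (fun b a => F (f a) b)) gi => [e ei|j jn].
  rewrite minor_tr; apply: (IH (f \o succn) e) => //; first by lia.
  by case: fi => fi fb; split=> i im; [apply: fi; lia|apply: fb; lia].
by rewrite minor_tr; apply: col.
Qed.
End Fekete.

(** * Positive semidefinite matrices *)

Section QuadraticForms.
Variable R : rcfType.

Definition qf n (A : 'M[R]_n) (v : 'I_n -> R) : R :=
  \sum_i \sum_j v i * A i j * v j.

Definition psd n (A : 'M[R]_n) : Prop := forall v, 0 <= qf A v.

Definition pd n (A : 'M[R]_n) : Prop :=
  forall v, (exists i, v i != 0) -> 0 < qf A v.

Definition gram n (A : 'M[R]_n) : Prop :=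
  exists m (W : 'M[R]_(m, n)), A = W^T *m W.

Lemma qfD n (A B : 'M[R]_n) v : qf (A + B) v = qf A v + qf B v.
Proof.
rewrite /qf -big_split; apply: eq_bigr => i _; rewrite -big_split.
by apply: eq_bigr => j _; rewrite !mxE mulrDr mulrDl.
Qed.

Lemma qfZ n c (A : 'M[R]_n) v : qf (c *: A) v = c * qf A v.
Proof.
rewrite /qf mulr_sumr; apply: eq_bigr => i _; rewrite mulr_sumr.
by apply: eq_bigr => j _; rewrite !mxE; ring.
Qed.

(** Core of the Schur product theorem: the Hadamard product is the sum of [D A D], with [D] the
    diagonal matrix of each row of [W] in turn. *)
Lemma qf_hadamard_gram n m (A B : 'M[R]_n) (W : 'M[R]_(m, n)) v : B = W^T *m W ->
  qf (map2_mx *%R A B) v = \sum_x qf A (fun i => v i * W x i).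
Proof.
move=> ->; rewrite /qf [RHS]exchange_big; apply: eq_bigr => i _.
rewrite [RHS]exchange_big; apply: eq_bigr => j _.
rewrite !mxE !mulr_sumr mulr_suml; apply: eq_bigr => x _.
by rewrite !mxE; ring.
Qed.

Lemma qf_gram n m (W : 'M[R]_(m, n)) v :
  qf (W^T *m W) v = \sum_x (\sum_i W x i * v i) ^+ 2.
Proof.
under [RHS]eq_bigr do rewrite expr2 mulr_suml; rewrite [RHS]exchange_big.
apply: eq_bigr => i _; under [RHS]eq_bigr do rewrite mulr_sumr; rewrite [RHS]exchange_big.
apply: eq_bigr => j _; rewrite !mxE mulr_sumr mulr_suml.
by apply: eq_bigr => x _; rewrite !mxE; ring.
Qed.

Lemma gram_psd n (A : 'M[R]_n) : gram A -> psd A.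
Proof. by move=> [m [W ->]] v; rewrite qf_gram; apply: sumr_ge0 => x _; apply: sqr_ge0. Qed.

(** If the sum of squares vanishes at [v], then [W] kills [v], and so does the invertible [A]. *)
Lemma gram_unit_pd n (A : 'M[R]_n) : gram A -> A \in unitmx -> pd A.
Proof.
move=> [m [W ->]] Au v [i vi]; rewrite lt0r qf_gram sumr_ge0 ?andbT => [|x _]; last exact: sqr_ge0.
apply: contra vi => /eqP/psumr_eq0P W0.
have {}W0 : W *m \col_j v j = 0.
  apply/matrixP=> x y; rewrite !mxE.
  under eq_bigr do rewrite mxE.
  by apply/eqP; rewrite -sqrf_eq0 W0 // => z _; apply: sqr_ge0.
have /matrixP/(_ i 0) : \col_j v j = 0.
  by rewrite -(mulKmx Au (\col_j v j)) -[_ *m W *m _]mulmxA W0 !mulmx0.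
by rewrite !mxE => ->.
Qed.

Lemma psd_hadamard n (A B : 'M[R]_n) : psd A -> gram B -> psd (map2_mx *%R A B).
Proof.
by move=> pA [m [W BW]] v; rewrite (qf_hadamard_gram _ _ BW); apply: sumr_ge0 => x _; apply: pA.
Qed.

Lemma pd_diag n (A : 'M[R]_n) i : pd A -> 0 < A i i.
Proof.
move=> /(_ (fun j => (j == i)%:R)) pA.
have : 0 < qf A (fun j => (j == i)%:R) by apply: pA; exists i; rewrite eqxx oner_eq0.
rewrite /qf (bigD1 i) //= [X in _ + X]big1 => [|j /negPf ->]; last by rewrite big1 // => k _; rewrite !mul0r.
rewrite addr0 (bigD1 i) //= [X in _ + X]big1 => [|j /negPf ->]; last by rewrite mulr0.
by rewrite eqxx !addr0 mulr1 mul1r.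
Qed.

Lemma pd_psd n (A : 'M[R]_n) : pd A -> psd A.
Proof.
move=> pA v; have [/existsP vi|] := boolP [exists i, v i != 0]; first exact/ltW/pA.
rewrite negb_exists => /forallP v0; apply: sumr_ge0 => i _; apply: sumr_ge0 => j _.
by have := v0 i; rewrite negbK => /eqP ->; rewrite !mul0r.
Qed.

Lemma pd_hadamard n (A B : 'M[R]_n) :
  pd A -> gram B -> pd B -> pd (map2_mx *%R A B).
Proof.
move=> pA [m [W BW]] pB v [i vi]; rewrite (qf_hadamard_gram _ _ BW).
have pA' := pd_psd pA.
rewrite lt0r sumr_ge0 ?andbT => [|x _]; last exact: pA'.
apply/negP => /eqP/psumr_eq0P q0.
(* As [A] is definite, every vector [v] scaled by a row of [W] is zero; since [v i != 0], column [i]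
   of [W] vanishes, against [0 < B i i]. *)
have Wi x : W x i = 0.
  apply: contra_eq (q0 (fun y _ => pA' _) x isT) => Wx; rewrite gt_eqF //.
  by apply: pA; exists i; rewrite mulf_neq0.
have := pd_diag i pB; rewrite BW mxE big1 ?ltxx // => x _.
by rewrite Wi mulr0.
Qed.

(* All eigenvalues of [- A] are negative, so its monic characteristic polynomial, whose value at 0 is [\det A], has no root on [0, +oo[. *)
Lemma pd_det n (A : 'M[R]_n) : pd A -> 0 < \det A.
Proof.
move=> pA; pose p := char_poly (- A).
have p0 : p.[0] = \det A.
  by rewrite horner_coef0 char_poly_det -detZ scaleN1r opprK.
have noroot x : 0 <= x -> ~~ root p x.
  move=> x0; rewrite -eigenvalue_root_char; apply/negP => /eigenvalueP [v vA v0].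
  have /rV0Pn [i vi] := v0.
  have : 0 < qf A (v 0) by apply: pA; exists i.
  have -> : qf A (v 0) = - x * \sum_j v 0 j ^+ 2.
    rewrite /qf exchange_big mulr_sumr; apply: eq_bigr => j _.
    rewrite -mulr_suml; move/matrixP: vA => /(_ 0 j); rewrite !mxE => e.
    rewrite expr2 mulrA mulNr -e; congr (_ * _); rewrite -sumrN.
    by apply: eq_bigr => k _; rewrite mxE mulrN opprK.
  by rewrite mulNr oppr_gt0 ltNge mulr_ge0 // sumr_ge0 // => j _; apply: sqr_ge0.
rewrite -p0 ltNge; apply/negP => p0le.
(* Far out, [p] is at least its leading coefficient 1, so [p.[0] <= 0] would force a nonnegative
   root. *)
have [|M HM] := @polyrcf.poly_pinfty_gt_lc R p; first by rewrite (monicP (char_poly_monic _)) ltr01.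
have Mp : 0 <= p.[Num.max 0 M].
  by apply: le_trans (HM _ _); rewrite ?(monicP (char_poly_monic _)) ?ler01 // le_max lexx orbT.
have M0 : 0 <= Num.max 0 M by rewrite le_max lexx.
have [x] := poly_ivt M0 (introT andP (conj p0le Mp)).
by move=> /andP[x0 _]; apply/negP/noroot.
Qed.

(** * Schur complements and Gram factorisation *)

Lemma det_schur n (A : 'M[R]_(1 + n)) (a := A 0 0) : a != 0 ->
  \det A = a * \det (\matrix_(i, j) (A (lift 0 i) (lift 0 j) - A (lift 0 i) 0 * A 0 (lift 0 j) / a)).
Proof.
move=> a0; set S := \matrix_(i, j) _.
(* One step of block LU elimination; both factors are block triangular. *)
have -> : A = block_mx 1 0 (a^-1 *: dlsubmx A) 1%:M *m block_mx a%:M (ursubmx A) 0 S.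
  rewrite mulmx_block !mul1mx !mul0mx !addr0 -scalemxAl -[LHS]submxK.
  have l0 : lshift n (0 : 'I_1) = 0 by apply: val_inj.
  have r0 i : rshift 1 i = lift 0 i by apply: val_inj.
  congr block_mx.
  - by apply/matrixP=> i j; rewrite !ord1 !mxE l0.
  - by rewrite mul_mx_scalar scalerA mulVf // scale1r.
  - apply/matrixP=> i j; rewrite !mxE big_ord1 !mxE l0 !r0; field.
    exact: a0.
by rewrite det_mulmx det_lblock det_ublock !det1 det_scalar1 !mul1r.
Qed.

Lemma det_mx22 (A : 'M[R]_2) :
  \det A = A ord0 ord0 * A ord_max ord_max - A ord0 ord_max * A ord_max ord0.
Proof.
rewrite (expand_det_row _ ord0) !big_ord_recl big_ord0 addr0 /cofactor !det_mx11 !mxE /=.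
have e1 : lift ord0 (ord0 : 'I_1) = ord_max :> 'I_2 by apply: val_inj.
have e2 : lift ord_max (ord0 : 'I_1) = ord0 :> 'I_2 by apply: val_inj.
by rewrite !e1 e2 expr0 mul1r expr1 mulN1r mulrN.
Qed.

(* Cholesky elimination: a zero pivot forces its row and column to vanish, by the 2 x 2 principal minors, and [x / 0 = 0] makes the Schur complement correct in that case too. *)
Lemma principal_minors_gram n (A : 'M[R]_n) : A^T = A ->
  (forall k (f : 'I_k -> 'I_n), increasing f -> 0 <= \det (mxsub f f A)) -> gram A.
Proof.
elim: n A => [|n IH] A sA mA.
  by exists 0%N, 0; apply/matrixP=> [[]].
have symA i j : A i j = A j i by rewrite -{1}sA mxE.
pose a := A ord0 ord0.
have a0 : 0 <= a.
  have := mA 1%N (fun _ => ord0); rewrite det_mx11 mxE; apply.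
  by move=> i j; rewrite !ord1.
have row0 : a = 0 -> forall j, A ord0 j = 0.
  move=> az j; case: (unliftP ord0 j) => [i ->|-> //].
  have := mA 2%N (fun x => if x == ord0 then ord0 else lift ord0 i).
  rewrite det_mx22 !mxE /= -/a az mul0r sub0r (symA (lift _ _)) oppr_ge0 -expr2 => h.
  apply/eqP; rewrite -sqrf_eq0 eq_le sqr_ge0 andbT; apply: h.
  by case=> [[|[|[]]] ?] // [[|[|[]]] ?].
pose S := \matrix_(i, j) (A (lift ord0 i) (lift ord0 j) - A (lift ord0 i) ord0 * A ord0 (lift ord0 j) / a).
have [||m [W SW]] := IH S.
- by apply/matrixP=> i j; rewrite !mxE (symA (lift ord0 i) (lift ord0 j)) (symA (lift ord0 j) ord0) (symA ord0 (lift ord0 i)); ring.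
- move=> k f fi.
  have [az|an0] := eqVneq a 0.
    have -> : mxsub f f S = mxsub (lift ord0 \o f) (lift ord0 \o f) A.
      by apply/matrixP=> i j; rewrite !mxE az invr0 mulr0 subr0.
    by apply: mA => i j ij; rewrite /= ltnS; apply: fi.
  (* Adjoining the pivot index to [f] gives a principal minor of [A] equal to [a] times the minor of
     [S] on [f]. *)
  pose f' (i : 'I_(1 + k)) := if unlift ord0 i is Some j then lift ord0 (f j) else ord0.
  have f'0 : f' 0 = ord0 by rewrite /f' unlift_none.
  have f'S i : f' (lift 0 i) = lift ord0 (f i) by rewrite /f' liftK.
  have /mA : increasing f'.
    move=> i j; rewrite /f'.
    case: unliftP => [i' ->|->]; case: unliftP => [j' ->|->] //=.
    by rewrite !ltnS; apply: fi.
  rewrite det_schur !mxE !f'0 // -/a pmulr_rge0 ?lt_def ?an0 //.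
  congr (_ <= \det _); apply/matrixP=> i j; rewrite !mxE !f'S !f'0 //.
pose W0 j := A ord0 j / Num.sqrt a.
have W0a : W0 ord0 = Num.sqrt a.
  rewrite /W0 -/a -{1}(sqr_sqrtr a0) expr2.
  by have [->|s0] := eqVneq (Num.sqrt a) 0; [rewrite !mul0r|rewrite mulfK].
have W0W j : Num.sqrt a * W0 j = A ord0 j.
  have [az|an0] := eqVneq a 0; first by rewrite (row0 az) /W0 (row0 az) mul0r mulr0.
  by rewrite /W0 mulrC divfK // sqrtr_eq0 -ltNge lt_def an0.
(* [W] bordered by the Cholesky row [W0] on top and zeros on the left: the row restores the rank one
   term subtracted in [S]. *)
pose W' (x : 'I_(1 + m)) (j : 'I_n.+1) := if unlift 0 x is Some y then
   (if unlift ord0 j is Some j' then W y j' else 0) else W0 j.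
exists (1 + m)%N, (\matrix_(x, j) W' x j).
apply/matrixP=> i j; rewrite !mxE big_ord_recl !mxE.
have W'0 l : W' ord0 l = W0 l by rewrite /W' unlift_none.
rewrite !W'0.
have -> : \sum_(x < m) (\matrix_(x, j) W' x j)^T i (lift ord0 x) * (\matrix_(x, j) W' x j) (lift ord0 x) j
  = if (unlift ord0 i, unlift ord0 j) is (Some i', Some j') then S i' j' else 0.
  under eq_bigr do rewrite !mxE /W' liftK.
  case: (unliftP ord0 i) => [i' _|_]; last by rewrite big1 // => x _; rewrite mul0r.
  case: (unliftP ord0 j) => [j' _|_]; last by rewrite big1 // => x _; rewrite mulr0.
  by rewrite SW !mxE; apply: eq_bigr => x _; rewrite mxE.
case: (unliftP ord0 i) => [i' ->|->]; last by rewrite addr0 W0a W0W.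
case: (unliftP ord0 j) => [j' ->|->]; last by rewrite addr0 W0a mulrC W0W symA.
rewrite !mxE /W0 (symA _ ord0) -{3}(sqr_sqrtr a0) invfM; ring.
Qed.

(** * Moment matrices and passage to the limit *)

Definition moment (n i j : nat) : R := \sum_(x < n) x.+1%:R ^+ (i + j).

(** The form sums [t ^+ (i + j) * p.[t] ^+ 2] over the positive nodes [1, ..., n], with [p] the
    polynomial of coefficients [v]; a nonzero [p] of size at most [n] cannot vanish at all [n]
    nodes. *)
Lemma moment_pd n k i j : (k <= n)%N ->
  pd (\matrix_(x < k, y < k) moment n (i + x) (j + y)).
Proof.
move=> kn v [l vl]; pose p := \poly_(x < k) (if insub x is Some o then v o else 0).
have pE (t : R) : p.[t] = \sum_(x < k) v x * t ^+ x.
  by rewrite horner_poly; apply: eq_bigr => x _; rewrite valK.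
have -> : qf (\matrix_(x, y) moment n (i + x) (j + y)) v =
   \sum_(t < n) t.+1%:R ^+ (i + j) * p.[t.+1%:R] ^+ 2.
  under [RHS]eq_bigr do rewrite pE expr2 mulr_suml mulr_sumr; rewrite [RHS]exchange_big.
  apply: eq_bigr => x _; under [RHS]eq_bigr do rewrite mulr_sumr mulr_sumr; rewrite [RHS]exchange_big.
  apply: eq_bigr => y _; rewrite mxE mulr_sumr mulr_suml; apply: eq_bigr => t _.
  by rewrite !exprD; ring.
have ge0 t : 0 <= (t.+1%:R : R) ^+ (i + j) * p.[t.+1%:R] ^+ 2.
  by apply: mulr_ge0; [rewrite exprn_ge0 ?ler0n|exact: sqr_ge0].
rewrite lt0r sumr_ge0 ?andbT //; apply: contra vl => /eqP/psumr_eq0P q0.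
have p0 : p = 0.
  apply/eqP; apply: contraT => pn0.
  have := @max_poly_roots R p [seq t.+1%:R | t <- iota 0 n] pn0.
  rewrite size_map size_iota => h.
  have : (n < size p)%N.
    apply: h.
      apply/allP=> y /mapP[t]; rewrite mem_iota add0n => /andP[_ tn] ->.
      have /eqP := q0 (fun t _ => ge0 t) (Ordinal tn) isT.
      rewrite mulf_eq0 expf_eq0 pnatr_eq0 andbF sqrf_eq0 /=.
      by rewrite /root.
    by rewrite map_inj_uniq ?iota_uniq // => s t /eqP; rewrite eqr_nat => /eqP[].
  by rewrite ltnNge (leq_trans (size_poly _ _) kn).
have : p`_l = v l by rewrite coef_poly ltn_ord valK.
by rewrite p0 coef0 => <-.
Qed.

(** The determinant is a polynomial in [e]. Were it negative at 0, the intermediate value theorem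
    would give it a root in []0, 1]]. *)
Lemma det_limit n (A B : 'M[R]_n) :
  (forall e, 0 < e -> 0 < \det (A + e *: B)) -> 0 <= \det A.
Proof.
move=> h; pose p := \det (map_mx polyC A + 'X *: map_mx polyC B).
have pE e : p.[e] = \det (A + e *: B).
  rewrite -horner_evalE -det_map_mx; congr (\det _); apply/matrixP=> i j.
  by rewrite !mxE /= /horner_eval !hornerE.
have p0 : p.[0] = \det A by rewrite pE scale0r addr0.
rewrite -p0 leNgt; apply/negP => p0lt.
have p1 : 0 <= p.[1] by rewrite pE ltW // h.
have [x] := poly_ivt ler01 (introT andP (conj (ltW p0lt) p1)).
move=> /andP[x0 _] /rootP px.
have [xe|xn] := eqVneq x 0; first by move: p0lt; rewrite xe in px; rewrite px ltxx.
by have := h x; rewrite -pE px ltxx lt_def xn x0 => /(_ isT).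
Qed.
End QuadraticForms.

(** * Contiguous blocks of Hankel matrices *)

Section HankelBlocks.
Variables (R : realType) (n : nat).
Implicit Types A B : 'M[R]_n.+1.

(** [inord] sends an index out of range to 0, hence the bounds [i + k <= n.+1] and [j + k <= n.+1]
    below. *)
Definition block A k i j : 'M[R]_k :=
  \matrix_(x, y) A (inord (i + x)) (inord (j + y)).

Lemma incr_on_increasing k f : incr_on k n.+1 f ->
  increasing (fun x : 'I_k => inord (f x) : 'I_n.+1).
Proof.
move=> fi x y xy; have [_ fb] := fi; rewrite !inordK ?fb //.
have := incr_onP (i := x) (d := y - x) fi; rewrite subnKC ?(ltnW xy) // => /(_ (ltn_ord y)).
lia.
Qed.

Lemma increasing_incr_on k (f : 'I_k.+1 -> 'I_n.+1) : increasing f ->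
  incr_on k.+1 n.+1 (fun x => f (inord x)).
Proof. by move=> fi; split=> x xk //; apply: fi; rewrite !inordK // ltnW. Qed.

Lemma hankel_block_tr A k i j : hankel A ->
  (i + k <= n.+1)%N -> (j + k <= n.+1)%N -> (block A k i j)^T = block A k i j.
Proof.
move=> hA ik jk; apply/matrixP=> x y; rewrite !mxE; apply: hA.
by have := ltn_ord x; have := ltn_ord y => *; rewrite !inordK; lia.
Qed.

(** The block is symmetric, and its principal minors are minors of [A] of size at most [k <= r]. *)
Lemma hankel_TN_gram A r k i j : hankel A -> TN r A -> (k <= r)%N ->
  (i + k <= n.+1)%N -> (j + k <= n.+1)%N -> gram (block A k i j).
Proof.
move=> hA tA kr ik jk; apply: principal_minors_gram; first exact: hankel_block_tr.
move=> l f fi.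
have lk : (l <= k)%N.
  rewrite -[l]card_ord -[k]card_ord; apply: (@leq_card _ _ f).
  move=> x y fxy; apply: val_inj; case: (ltngtP x y) => // /fi; rewrite fxy ltnn //.
have -> : mxsub f f (block A k i j) =
    mxsub (fun x => inord (i + f x)) (fun x => inord (j + f x)) A.
  by apply/matrixP=> x y; rewrite !mxE.
apply: tA; first exact: leq_trans kr.
  by move=> x y /fi; have := ltn_ord (f x); have := ltn_ord (f y) => *; rewrite !inordK; lia.
by move=> x y /fi; have := ltn_ord (f x); have := ltn_ord (f y) => *; rewrite !inordK; lia.
Qed.

Lemma TP_TN A r : TP r A -> TN r A.
Proof. by move=> tA k f g kr fi gi; apply/ltW/tA. Qed.

Lemma hankel_TP_pd A r k i j : hankel A -> TP r A -> (k <= r)%N ->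
  (i + k <= n.+1)%N -> (j + k <= n.+1)%N -> pd (block A k i j).
Proof.
move=> hA tA kr ik jk; apply: gram_unit_pd.
  exact: hankel_TN_gram (TP_TN tA) kr ik jk.
have -> : block A k i j = mxsub (fun x : 'I_k => inord (i + x)) (fun x : 'I_k => inord (j + x)) A.
  by apply/matrixP=> x y; rewrite !mxE.
by rewrite unitmxE unitfE gt_eqF // tA //; apply/incr_on_increasing/incr_on_add.
Qed.

(** Definite blocks have positive determinant, which is the contiguous hypothesis of [fekete]. *)
Lemma pd_blocks_TP A r :
  (forall k i j, (k <= r)%N -> (i + k <= n.+1)%N -> (j + k <= n.+1)%N ->
     pd (block A k i j)) -> TP r A.
Proof.
move=> pA [|k] f g kr fi gi; first by rewrite det_mx00.
have -> : \det (mxsub f g A) =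
    minor (fun i j => A (inord i) (inord j)) k.+1 (fun x => f (inord x)) (fun x => g (inord x)).
  by congr (\det _); apply/matrixP=> x y; rewrite !mxE !inord_val.
apply: (@fekete _ _ n.+1 r) => //; try exact: increasing_incr_on.
by move=> {fi gi kr f g}k i j kr ik jk; apply/pd_det/pA.
Qed.

End HankelBlocks.

Theorem theorem4p5 (R : realType) (n r : nat) (hn : (1 <= n)%N) (hr : (1 <= r)%N) :
  (forall A B : 'M[R]_n, hankel A -> hankel B ->
     TN r A -> TN r B -> TN r (hadamard A B))
  /\
  (forall A B : 'M[R]_n, hankel A -> hankel B ->
     TP r A -> TP r B -> TP r (hadamard A B)).
Proof.
case: n hn => // n _.
have blockM (A B : 'M[R]_n.+1) k i j :
    block (hadamard A B) k i j = map2_mx *%R (block A k i j) (block B k i j).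
  by apply/matrixP=> x y; rewrite !mxE.
split=> A B hA hB tA tB; last first.
  apply: pd_blocks_TP => k i j kr ik jk; rewrite blockM.
  apply: pd_hadamard; [exact: hankel_TP_pd tA _ _ _| |exact: hankel_TP_pd tB _ _ _].
  exact: hankel_TN_gram (TP_TN tB) _ _ _.
(* With [n.+1] nodes, contiguous blocks of every size up to [n.+1] are definite. *)
pose M : 'M[R]_n.+1 := \matrix_(x, y) moment R n.+1 x y.
have tp e : 0 < e -> TP r (hadamard A B + e *: M).
  move=> e0; apply: pd_blocks_TP => k i j kr ik jk.
  have -> : block (hadamard A B + e *: M) k i j = map2_mx *%R (block A k i j) (block B k i j) +
      e *: \matrix_(x < k, y < k) moment R n.+1 (i + x) (j + y).
    apply/matrixP=> x y; have := ltn_ord x; have := ltn_ord y => yk xk.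
    by rewrite !mxE !inordK //; lia.
  move=> v v0; rewrite qfD qfZ; apply: ltr_wpDl.
    apply: psd_hadamard; last exact: hankel_TN_gram tB _ _ _.
    exact/gram_psd/(hankel_TN_gram _ tA).
  by rewrite mulr_gt0 //; apply: moment_pd v0; lia.
(* The limit is taken separately for each minor. *)
move=> k f g kr fi gi; apply: (@det_limit _ _ _ (mxsub f g M)) => e e0.
have := tp e e0 k f g kr fi gi.
by congr (_ < \det _); apply/matrixP=> x y; rewrite !mxE.
Qed.
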